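(* Let $\mathcal{P}$ be a $d$-dimensional integral polytope with Ehrhart polynomial $i(\mathcal{P},t)=1+\sum_{i=1}^{d}c_it^i$, where each $c_i\neq0$. Then there exists a $(d+2)$-dimensional integral polytope $\mathcal{Q}$ with Ehrhart polynomial $i(\mathcal{Q},t)=1+\sum_{i=1}^{d+2}h_it^i$ such that $\mathrm{sgn}(h_i)=\mathrm{sgn}(c_{i-2})$ for all $4\le i\le d$, $\mathrm{sgn}(h_2)=+1$, and $\mathrm{sgn}(h_1)=\mathrm{sgn}(h_3)=\mathrm{sgn}(c_1)$.
   Context: An integral polytope is a convex polytope all of whose vertices have integer coordinates. For an integral polytope $\mathcal{P}\subseteq\mathbb{R}^N$ of dimension $d$, $i(\mathcal{P},t)=|t\mathcal{P}\cap\mathbb{Z}^N|$ ($t$ a positive integer) is a polynomial in $t$ of degree $d$ with constant term $1$, the Ehrhart polynomial. $\mathrm{sgn}(x)\in\{-1,0,+1\}$ denotes the sign of a real number $x$, with $\mathrm{sgn}(0)=0$. Throughout, dimensions $d$ are assumed to satisfy $d\ge3$. *)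

(* Defs.v *)
From mathcomp Require Import all_boot all_order all_algebra.
From mathcomp Require Import finmap.
From mathcomp Require Import boolp classical_sets cardinality reals.

Set Implicit Arguments.
Unset Strict Implicit.
Unset Printing Implicit Defensive.

Import Order.TTheory GRing.Theory Num.Theory.

Local Open Scope classical_set_scope.
Local Open Scope ring_scope.

Section Polytopes.
Context {R : realType} {N : nat}.
Implicit Types P : set 'rV[R]_N.

Definition convex_hull (m : nat) (p : 'I_m -> 'rV[R]_N) : set 'rV[R]_N :=
  [set x | exists w : 'I_m -> R,
     [/\ forall i, 0 <= w i, \sum_i w i = 1 & x = \sum_i w i *: p i]].

Definition polytope P : Prop :=
  exists (m : nat) (p : 'I_m -> 'rV[R]_N), P = convex_hull p.

Definition vertex P (v : 'rV[R]_N) : Prop :=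
  P v /\ forall (x y : 'rV[R]_N) (a : R), P x -> P y -> 0 < a < 1 ->
    v = a *: x + (1 - a) *: y -> x = v /\ y = v.

Definition integral_polytope P : Prop :=
  polytope P /\ forall v, vertex P v -> v \is a mxOver Num.int.

(* The affine hull of P is x0 + U, where U is the smallest linear subspace
   containing P - x0; a polytope with a dimension is in particular nonempty. *)
Definition has_dim P (d : nat) : Prop :=
  exists2 x0, P x0 & exists U : {vspace 'rV[R]_N},
    [/\ forall x, P x -> x - x0 \in U,
        forall W : {vspace 'rV[R]_N},
          (forall x, P x -> x - x0 \in W) -> (U <= W)%VS
      & \dim U = d].

(* fset_set sends infinite sets to the empty fset; this does not occur for
   polytopes, which are bounded. *)
Definition lattice_count P (t : nat) : nat :=
  #|` fset_set ([set t%:R *: x | x in P] `&`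
                [set z : 'rV[R]_N | z \is a mxOver Num.int]) |%fset.

(* A polynomial is determined by its values at the positive integers, so at
   most one q satisfies this. *)
Definition ehrhart_poly P (q : {poly R}) : Prop :=
  forall t : nat, (0 < t)%N -> q.[t%:R] = (lattice_count P t)%:R.

End Polytopes.

(* Main.v *)
(* Q is the product of a dilate mP and a lattice parallelogram with Ehrhart
   polynomial 1 + 2t + q t^2. Ehrhart polynomials multiply under products, so
   h_i = m^i c_i + 2 m^(i-1) c_(i-1) + q m^(i-2) c_(i-2), with c_0 = 1. First m
   is taken so large that m |c_1| > 2, which settles h_1 = m c_1 + 2; since the
   boundary term 2 does not depend on q, the area q can then be taken so large
   that the last summand dominates h_i for all i >= 2. *)
Require Import Defs.
From mathcomp Require Import all_boot all_order all_algebra.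
From mathcomp Require Import finmap ring lra zify.
From mathcomp Require Import boolp classical_sets cardinality reals.

Import Order.TTheory GRing.Theory Num.Theory.
Local Open Scope ring_scope.
Local Open Scope classical_set_scope.

(** * Cardinalities of images and products of sets *)

Lemma card_fset_set_image {T U : choiceType} (f : T -> U) (A : set T) :
  injective f -> #|` fset_set (f @` A)|%fset = #|` fset_set A|%fset.
Proof.
move=> f_inj; have [finA|infA] := pselect (finite_set A).
  by rewrite fset_set_image // card_imfset.
(* An injective image of an infinite set is infinite, so [fset_set] takes its default value, the
   empty fset, on both sides. *)
have infA' : ~ finite_set (f @` A).
  by rewrite (eq_finite_set (inj_card_eq _)) // => x y _ _; apply: f_inj.
by rewrite /fset_set; case: pselect => //; case: pselect.
Qed.

Lemma card_fsetM {T U : choiceType} (A : {fset T}) (B : {fset U}) :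
  #|` (A `*` B)|%fset = (#|` A|%fset * #|` B|%fset)%N.
Proof.
rewrite -(size_allpairs pair A B); apply/perm_size/uniq_perm => //.
  by rewrite allpairs_uniq // => -[a b] [a' b'].
case=> a b; rewrite in_fsetM; apply/andP/allpairsP => [[Aa Bb]|].
  by exists (a, b).
by case=> -[a' b'] [Aa Bb [-> ->]].
Qed.

(* Holds for infinite sets too, thanks to the junk value of fset_set. *)
Lemma card_fset_setX {T U : choiceType} (A : set T) (B : set U) :
  #|` fset_set (A `*` B)|%fset = (#|` fset_set A|%fset * #|` fset_set B|%fset)%N.
Proof.
have inf0 (V : choiceType) (C : set V) : ~ finite_set C -> fset_set C = fset0.
  by rewrite /fset_set; case: pselect.
have [finA|infA] := pselect (finite_set A); have [finB|infB] := pselect (finite_set B).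
- by rewrite fset_setX // card_fsetM.
- rewrite (inf0 _ _ infB) cardfs0 muln0.
  have [->|/set0P[a Aa]] := eqVneq A set0; first by rewrite set0X fset_set0 cardfs0.
  rewrite inf0 ?cardfs0 // => /(finite_image snd); apply: contra_not infB.
  by apply: sub_finite_set => b Bb; exists (a, b).
- rewrite (inf0 _ _ infA) cardfs0 mul0n.
  have [->|/set0P[b Bb]] := eqVneq B set0; first by rewrite setX0 fset_set0 cardfs0.
  rewrite inf0 ?cardfs0 // => /(finite_image fst); apply: contra_not infA.
  by apply: sub_finite_set => a Aa; exists (a, b).
- by rewrite !inf0 ?cardfs0 // => /finite_setX_or[].
Qed.

(** * Convex hulls of finite families and their vertices *)

Section Hulls.
Context {R : realType} {N : nat}.
Implicit Types P : set 'rV[R]_N.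

(** Permits hulls of families indexed by any finite type, such as pairs, although [convex_hull]
    expects an ordinal: weights are transported along the enumeration of [I]. *)
Lemma convex_hull_fin (I : finType) (p : I -> 'rV[R]_N) :
  convex_hull (p \o @enum_val I I) = [set x | exists w : I -> R,
     [/\ forall i, 0 <= w i, \sum_i w i = 1 & x = \sum_i w i *: p i]].
Proof.
apply/seteqP; split=> x [w [w0 w1 ->]].
  exists (w \o enum_rank); split=> [i| |]; first exact: w0.
  - by rewrite -w1 [RHS](reindex _ (onW_bij _ (enum_rank_bij I))).
  - rewrite [LHS](reindex _ (onW_bij _ (enum_rank_bij I))) /=.
    by apply: eq_bigr => i _; rewrite enum_rankK.
exists (w \o enum_val); split=> [i| |]; first exact: w0.
- by rewrite -w1 [RHS](reindex _ (onW_bij _ (enum_val_bij I))).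
- by rewrite [LHS](reindex _ (onW_bij _ (enum_val_bij I))).
Qed.

Lemma convex_hull_point {m} (p : 'I_m -> 'rV[R]_N) i : convex_hull p (p i).
Proof.
exists (fun j => (j == i)%:R); split=> [j| |]; first exact: ler0n.
- by rewrite (bigD1 i) //= eqxx big1 ?addr0 // => j /negPf ->.
- rewrite (bigD1 i) //= eqxx scale1r big1 ?addr0 // => j /negPf ->.
  by rewrite scale0r.
Qed.

(** Some generator [p i] has positive weight in [v]. If its weight is 1, then [v] is [p i];
    otherwise [v] lies strictly between [p i] and a point of the hull, and extremality forces
    [p i = v]. *)
Lemma vertex_convex_hull {m} (p : 'I_m -> 'rV[R]_N) v :
  vertex (convex_hull p) v -> exists i, v = p i.
Proof.
move=> [[w [w0 w1 def_v]] extr].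
have [i wi0] : exists i, w i != 0.
  apply/existsP; apply: contraT; rewrite negb_exists => /forallP h.
  suff: (1 : R) = 0 by move/eqP; rewrite oner_eq0.
  by rewrite -w1 big1 // => i _; apply/eqP; have := h i; rewrite negbK.
exists i; have wi_gt0 : 0 < w i by rewrite lt0r wi0 w0.
have rest : \sum_(j | j != i) w j = 1 - w i.
  by rewrite -w1 [in RHS](bigD1 i) //= addrAC subrr add0r.
(* If [w i] is at least 1, the other weights are nonnegative with sum at most 0, hence all
   vanish. *)
have [wi1|wi_lt1] := leP 1 (w i).
  have rest0 : \sum_(j | j != i) w j = 0.
    apply/eqP; rewrite eq_le sumr_ge0 ?andbT => [|j _]; last exact: w0.
    by rewrite rest subr_le0.
  have wE : w i = 1.
    by apply/eqP; rewrite eq_sym -subr_eq0 -rest rest0.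
  rewrite def_v (bigD1 i) //= wE scale1r big1 ?addr0 // => j ji.
  suff -> : w j = 0 by rewrite scale0r.
  by apply/eqP; move/eqP: rest0; rewrite psumr_eq0 // => /allP/(_ j); rewrite mem_index_enum ji /= => ->.
have u0 : 1 - w i != 0 by rewrite subr_eq0 gt_eqF.
(* The remaining generators with weights rescaled to sum to 1, so that [v] is
   [w i *: p i + (1 - w i) *: y]. *)
pose y := \sum_(j | j != i) (w j / (1 - w i)) *: p j.
have Py : convex_hull p y.
  exists (fun j => if j != i then w j / (1 - w i) else 0); split.
  - move=> j; case: ifP => // _; rewrite divr_ge0 ?w0 ?subr_ge0 //.
    exact: ltW.
  - by rewrite -big_mkcond -mulr_suml rest divff.
  - rewrite /y big_mkcond; apply: eq_bigr => j _.
    by case: ifP; rewrite ?scale0r.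
have [||<- //] := extr _ y (w i) (convex_hull_point p i) Py.
- by rewrite wi_gt0.
- rewrite def_v (bigD1 i) //=; congr (_ + _).
  rewrite scaler_sumr; apply: eq_bigr => j _.
  by rewrite scalerA mulrC divfK.
Qed.

Lemma integral_convex_hull {m} (p : 'I_m -> 'rV[R]_N) :
  (forall i, p i \is a mxOver Num.int) -> integral_polytope (convex_hull p).
Proof.
move=> p_int; split; first by exists m, p.
by move=> v /vertex_convex_hull [i ->].
Qed.

End Hulls.

(** * Dilates of a polytope *)

Section Dilation.
Context {R : realType} {N : nat}.
Variables (P : set 'rV[R]_N) (m : nat).
Hypothesis m_gt0 : (0 < m)%N.
Let dilate := [set m%:R *: x | x in P].
Let m_neq0 : m%:R != 0 :> R. Proof. by rewrite pnatr_eq0 -lt0n. Qed.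

Lemma dilate_integral : integral_polytope P -> integral_polytope dilate.
Proof.
move=> [[n [p defP]] intP]; split.
  exists n, (fun i => m%:R *: p i); rewrite /dilate defP.
  apply/seteqP; split=> x.
    move=> [_ [w [w0 w1 ->]] <-]; exists w; split=> //.
    by rewrite scaler_sumr; apply: eq_bigr => i _; rewrite !scalerA mulrC.
  move=> [w [w0 w1 ->]]; exists (\sum_i w i *: p i); first by exists w.
  by rewrite scaler_sumr; apply: eq_bigr => i _; rewrite !scalerA mulrC.
move=> _ [[x Px <-] extr].
(* A vertex of the dilate is [m] times a vertex of [P]: a segment of [P] around [x] scales to a
   segment of the dilate around [m%:R *: x]. *)
suff /intP /mxOverP x_int : vertex P x.
  by apply/mxOverP => i j; rewrite mxE rpredM ?rpred_nat.
split=> // y z a Py Pz a01 def_x.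
have [|||] := extr (m%:R *: y) (m%:R *: z) a _ _ a01; first by exists y.
- by exists z.
- by rewrite def_x scalerDr !scalerA ![m%:R * _]mulrC.
by move=> /(scalerI m_neq0) -> /(scalerI m_neq0) ->.
Qed.

(** The direction space [U] itself serves for the dilate, since scaling by the nonzero [m] preserves
    every subspace in both directions. *)
Lemma dilate_has_dim d : has_dim P d -> has_dim dilate d.
Proof.
move=> [x0 Px0 [U [subU minU dimU]]]; exists (m%:R *: x0); first by exists x0.
exists U; split=> // [_ [x Px <-]|W subW].
  by rewrite -scalerBr rpredZ ?subU.
apply: minU => x Px; rewrite -[_ - _](scalerK m_neq0) rpredZ //.
by rewrite scalerBr subW //; exists x.
Qed.

Lemma lattice_count_dilate t : lattice_count dilate t = lattice_count P (t * m).
Proof.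
rewrite /lattice_count; congr (#|` fset_set (_ `&` _) |)%fset.
apply/seteqP; split=> [_ [_ [x Px <-] <-]|_ [x Px <-]].
  by exists x => //; rewrite scalerA natrM.
by exists (m%:R *: x); [exists x|rewrite scalerA natrM].
Qed.

End Dilation.

(** * Cartesian products, with pairs encoded as concatenated row vectors *)

Definition set_row_mx {R : realType} {N M : nat} (P : set 'rV[R]_N)
    (T : set 'rV[R]_M) : set 'rV[R]_(N + M) :=
  [set z | P (lsubmx z) /\ T (rsubmx z)].

Lemma set_row_mx_row {R : realType} {N M : nat} (P : set 'rV[R]_N)
    (T : set 'rV[R]_M) x y : set_row_mx P T (row_mx x y) = (P x /\ T y).
Proof. by rewrite /set_row_mx /= row_mxKl row_mxKr. Qed.

Section Product.
Context {R : realType} {N M : nat}.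
Variables (P : set 'rV[R]_N) (T : set 'rV[R]_M).

(** The product is the hull of all pairs of generators: weights on the factors multiply to weights
    on pairs, and weights on pairs have marginals on the factors. *)
Lemma set_row_mx_polytope : polytope P -> polytope T -> polytope (set_row_mx P T).
Proof.
(* The generating family, left open here, is supplied by [convex_hull_fin] for the index type of
   pairs. *)
move=> [m [p ->]] [n [q ->]]; do 2!eexists.
suff -> : set_row_mx (convex_hull p) (convex_hull q) =
  [set x | exists w : 'I_m * 'I_n -> R,
     [/\ forall i, 0 <= w i, \sum_i w i = 1
       & x = \sum_i w i *: row_mx (p i.1) (q i.2)]] by rewrite -convex_hull_fin.
have row_sum (w : 'I_m * 'I_n -> R) :
    \sum_i w i *: row_mx (p i.1) (q i.2) =
    row_mx (\sum_i w i *: p i.1) (\sum_i w i *: q i.2).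
  apply: (big_ind3 (fun a b c => a = row_mx b c)) => [|? ? ? ? ? ? -> ->|i _].
  - by rewrite row_mx0.
  - by rewrite add_row_mx.
  - by rewrite scale_row_mx.
apply/seteqP; split=> z.
  move=> [[w [w0 w1 defl]] [v [v0 v1 defr]]].
  exists (fun i => w i.1 * v i.2); split.
  - by move=> i; rewrite mulr_ge0.
  - rewrite -(pair_bigA _ (fun i j => w i * v j)) /= -w1.
    by apply: eq_bigr => i _; rewrite -mulr_sumr v1 mulr1.
  - rewrite row_sum -[LHS]hsubmxK defl defr; congr row_mx.
      rewrite -(pair_bigA _ (fun i j => (w i * v j) *: p i)) /=.
      by apply: eq_bigr => i _; rewrite -scaler_suml -mulr_sumr v1 mulr1.
    rewrite -(pair_bigA _ (fun i j => (w i * v j) *: q j)) /= exchange_big /=.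
    by apply: eq_bigr => j _; rewrite -scaler_suml -mulr_suml w1 mul1r.
move=> [w [w0 w1 ->]]; rewrite row_sum set_row_mx_row; split.
  exists (fun i => \sum_j w (i, j)); split.
  - by move=> i; rewrite sumr_ge0.
  - by rewrite pair_bigA -w1; apply: eq_bigr => -[].
  - under [RHS]eq_bigr do rewrite scaler_suml.
    by rewrite pair_bigA; apply: eq_bigr => -[].
exists (fun j => \sum_i w (i, j)); split.
- by move=> i; rewrite sumr_ge0.
- by rewrite exchange_big pair_bigA -w1; apply: eq_bigr => -[].
- under [RHS]eq_bigr do rewrite scaler_suml.
  by rewrite exchange_big pair_bigA; apply: eq_bigr => -[].
Qed.

(** Each half of a vertex is a vertex of its factor: a segment in one factor lifts to the product by
    freezing the other half. *)
Lemma set_row_mx_integral :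
  integral_polytope P -> integral_polytope T -> integral_polytope (set_row_mx P T).
Proof.
move=> [polP intP] [polT intT]; split; first exact: set_row_mx_polytope.
move=> v [[Pl Tr] extr].
have /intP/mxOverP l_int : vertex P (lsubmx v).
  split=> // x y a Px Py a01 def_v.
  have [||//||] := extr (row_mx x (rsubmx v)) (row_mx y (rsubmx v)) a.
  - by rewrite set_row_mx_row.
  - by rewrite set_row_mx_row.
  - rewrite !scale_row_mx add_row_mx -def_v -scalerDl addrC subrK scale1r.
    by rewrite hsubmxK.
  - by move=> <- /(congr1 lsubmx); rewrite !row_mxKl.
have /intT/mxOverP r_int : vertex T (rsubmx v).
  split=> // x y a Px Py a01 def_v.
  have [||//||] := extr (row_mx (lsubmx v) x) (row_mx (lsubmx v) y) a.
  - by rewrite set_row_mx_row.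
  - by rewrite set_row_mx_row.
  - rewrite !scale_row_mx add_row_mx -def_v -scalerDl addrC subrK scale1r.
    by rewrite hsubmxK.
  - by move=> <- /(congr1 rsubmx); rewrite !row_mxKr.
apply/mxOverP => i j; rewrite -[v]hsubmxK mxE.
by case: splitP => k _; rewrite ?l_int ?r_int.
Qed.

(** The direction space is the direct sum of the copies of [U] and [V] under the injective
    embeddings [fl] and [fr]. *)
Lemma set_row_mx_has_dim d e :
  has_dim P d -> has_dim T e -> has_dim (set_row_mx P T) (d + e).
Proof.
move=> [x0 Px0 [U [subU minU dimU]]] [y0 Ty0 [V [subV minV dimV]]].
exists (row_mx x0 y0); first by rewrite set_row_mx_row.
pose fl := linfun (mulmxr (row_mx 1%:M 0 : 'M[R]_(N, N + M)) : 'rV_N -> _).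
pose fr := linfun (mulmxr (row_mx 0 1%:M : 'M[R]_(M, N + M)) : 'rV_M -> _).
have flE x : fl x = row_mx x 0 by rewrite lfunE /= mul_mx_row mulmx1 mulmx0.
have frE y : fr y = row_mx 0 y by rewrite lfunE /= mul_mx_row mulmx1 mulmx0.
exists (fl @: U + fr @: V)%VS; split.
- move=> z [Pl Tr]; rewrite -[z]hsubmxK opp_row_mx add_row_mx.
  rewrite -[lsubmx z - x0]addr0 -[rsubmx z - y0]add0r -add_row_mx -flE -frE.
  by rewrite memv_add // memv_img ?subU ?subV.
- move=> W subW; rewrite subv_add; apply/andP; split; apply/subvP => _ /memv_imgP[x + ->];
    rewrite memv_preim; move: x; apply/subvP.
    (* The preimage of [W] under [fl] contains every [x - x0], as seen by comparing [row_mx x y0]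
       with the base point; likewise for [fr] with [x0] frozen. *)
    apply: minU => x Px.
    rewrite -memv_preim flE.
    have := subW (row_mx x y0); rewrite set_row_mx_row opp_row_mx add_row_mx.
    by rewrite subrr; apply.
  apply: minV => y Ty.
  rewrite -memv_preim frE.
  have := subW (row_mx x0 y); rewrite set_row_mx_row opp_row_mx add_row_mx.
  by rewrite subrr; apply.
- rewrite dimv_disjoint_sum; last first.
    apply/eqP; rewrite -subv0; apply/subvP => z; rewrite memv_cap memv0.
    case/andP => /memv_imgP[x _ ->] /memv_imgP[y _]; rewrite flE frE.
    by case/eq_row_mx => -> _; rewrite row_mx0.
  rewrite -dimU -dimV; congr addn; apply: limg_dim_eq;
    apply/eqP; rewrite -subv0; apply/subvP => z; rewrite memv_cap memv0;
    case/andP => _; rewrite memv_ker ?flE ?frE => /eqP; rewrite -(@row_mx0 _ 1).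
    by case/eq_row_mx => ->.
  by case/eq_row_mx => _ ->.
Qed.

Lemma lattice_count_set_row_mx t :
  lattice_count (set_row_mx P T) t = (lattice_count P t * lattice_count T t)%N.
Proof.
pose f (z : 'rV[R]_N * 'rV[R]_M) := row_mx z.1 z.2.
have f_inj : injective f by move=> [a b] [a' b'] /eq_row_mx [/= -> ->].
rewrite /lattice_count -card_fset_setX -(card_fset_set_image f) //.
congr (#|` fset_set _ |)%fset; apply/seteqP; split=> z.
  move=> [[y [Pl Tr] <-] /= z_int]; exists (t%:R *: lsubmx y, t%:R *: rsubmx y).
    split; split=> /=; [by exists (lsubmx y)| |by exists (rsubmx y)|].
      by apply/mxOverP => i j; have /mxOverP/(_ i (lshift M j)) := z_int; rewrite !mxE.
    by apply/mxOverP => i j; have /mxOverP/(_ i (rshift N j)) := z_int; rewrite !mxE.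
  by rewrite /f /= -scale_row_mx hsubmxK.
move=> [[a b] [[[x Px ax] /= a_int] [[y Ty yb] /= b_int]] <-]; split=> /=.
  move: ax yb => /= <- <-.
  by exists (row_mx x y); rewrite ?set_row_mx_row // scale_row_mx.
by apply/mxOverP => i j; rewrite mxE; case: splitP => k _; apply/mxOverP.
Qed.

End Product.

(** * The lattice parallelogram of area [q] and its lattice points *)

Section Parallelogram.
Context {R : realType}.
Variables (k : nat).
Let q := k.+1.

Definition rV2 (x y : R) : 'rV[R]_2 := \row_j (if j == 0 then x else y).

Lemma rV2E (z : 'rV[R]_2) : z = rV2 (z 0 0) (z 0 1).
Proof.
apply/rowP => j; rewrite mxE; case: eqP => [-> //|/eqP j0].
by congr (z 0 _); case: j j0 => -[|[|]] //= ? _; apply: val_inj.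
Qed.

Lemma rV20 x y : rV2 x y 0 0 = x. Proof. by rewrite mxE. Qed.
Lemma rV21 x y : rV2 x y 0 1 = y. Proof. by rewrite mxE. Qed.

(* The parallelogram spanned by (1, 0) and (1, q): its edges are primitive,
   so its area q is not bounded in terms of its boundary. *)
Definition parallelogram : set 'rV[R]_2 :=
  [set z | 0 <= z 0 1 <= q%:R /\ 0 <= q%:R * z 0 0 - z 0 1 <= q%:R].

Lemma parallelogram_integral : integral_polytope parallelogram.
Proof.
pose p (i : bool * bool) := rV2 (i.1%:R + i.2%:R) (q%:R * i.2%:R).
have sumBB (V : nmodType) (F : bool * bool -> V) :
    \sum_i F i = F (true, true) + F (true, false) + (F (false, true) + F (false, false)).
  transitivity (\sum_i F (i.1, i.2)); first by apply: eq_bigr => -[].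
  by rewrite -(pair_bigA _ (fun a b => F (a, b))) !big_bool.
have q_gt0 : 0 < q%:R :> R by rewrite ltr0n.
suff -> : parallelogram = convex_hull (p \o @enum_val _ {: bool * bool}).
  apply: integral_convex_hull => i; apply/mxOverP => a b; rewrite mxE.
  by case: ifP => _; rewrite ?rpredD ?rpredM ?rpred_nat.
rewrite convex_hull_fin; apply/seteqP; split=> z.
  move=> [/andP[y0 yq] /andP[x0 xq]].
  (* Coordinates in the basis (1, 0), (1, q): [z] is s (1, 0) + r (1, q), and the defining
     inequalities say that [r] and [s] lie in [0, 1]. *)
  pose r := z 0 1 / q%:R; pose s := z 0 0 - r.
  have zy : z 0 1 = q%:R * r by rewrite /r mulrC divfK ?gt_eqF.
  have zx : z 0 0 = s + r by rewrite subrK.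
  have r0 : 0 <= r by rewrite divr_ge0 // ltW.
  have r1 : r <= 1 by rewrite ler_pdivrMr // mul1r.
  have [s0 s1] : 0 <= s /\ s <= 1.
    by move: x0 xq; rewrite zx zy; split; nra.
  (* Bilinear weights: the unit square point (s, r) as a combination of the four corners. *)
  exists (fun i => (if i.1 then s else 1 - s) * (if i.2 then r else 1 - r)).
  split.
  - by move=> [a b]; apply: mulr_ge0; case: ifP => _ //; rewrite subr_ge0.
  - by rewrite sumBB /=; ring.
  - rewrite sumBB [LHS]rV2E zx zy; apply/rowP => j; rewrite !mxE /=.
    by case: ifP => _; ring.
move=> [w [w0 w1 ->]]; rewrite sumBB in w1.
have := (w0 (true, true), w0 (true, false), w0 (false, true), w0 (false, false)).
move=> [[[wtt wtf] wft] wff].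
rewrite /parallelogram /= sumBB !mxE /=.
by split; apply/andP; split; nra.
Qed.

Lemma parallelogram_has_dim : has_dim parallelogram 2.
Proof.
have q_neq0 : q%:R != 0 :> R by rewrite pnatr_eq0.
exists 0; first by rewrite /parallelogram /= !mxE mulr0 subr0 lexx ler0n.
exists fullv; split=> [x _|W subW|]; first exact: memvf.
  apply/subvP => z _; rewrite [z]rV2E.
  have e1 : rV2 1 0 \in W.
    rewrite -[rV2 _ _]subr0 subW // /parallelogram /= rV20 rV21.
    by rewrite mulr1 subr0 !lexx ler0n.
  have e2 : rV2 1 q%:R \in W.
    rewrite -[rV2 _ _]subr0 subW // /parallelogram /= rV20 rV21.
    by rewrite mulr1 subrr !lexx ler0n.
  have -> : rV2 (z 0 0) (z 0 1) =
      (z 0 0 - z 0 1 / q%:R) *: rV2 1 0 + (z 0 1 / q%:R) *: rV2 1 q%:R.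
    by apply/rowP => j; rewrite !mxE; case: ifP => _; field.
  by rewrite memvD // memvZ.
by rewrite dimvf dim_matrix.
Qed.

Lemma dilate_parallelogram t : (0 < t)%N ->
  [set t%:R *: x | x in parallelogram] =
  [set z | 0 <= z 0 1 <= (q * t)%:R /\ 0 <= q%:R * z 0 0 - z 0 1 <= (q * t)%:R].
Proof.
move=> t_gt0; have tR : 0 < t%:R :> R by rewrite ltr0n.
apply/seteqP; split=> [_ [z [y_bnd x_bnd] <-]|z [y_bnd x_bnd]].
  rewrite /= !mxE mulrCA -mulrBr natrM [q%:R * t%:R]mulrC.
  by rewrite !(pmulr_rge0 _ tR) !ler_pM2l.
exists (t%:R^-1 *: z); last by rewrite scalerA divff ?scale1r ?gt_eqF.
rewrite /parallelogram /= !mxE mulrCA -mulrBr.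
have tVR : 0 < t%:R^-1 :> R by rewrite invr_gt0.
by rewrite !(pmulr_rge0 _ tVR) ![_^-1 * _]mulrC !ler_pdivrMr // -natrM.
Qed.

(* The rows y = 0 mod q of the dilate have t + 1 lattice points each, the
   other ones t. *)
Lemma lattice_count_parallelogram t : (0 < t)%N ->
  lattice_count parallelogram t = (q * t ^ 2 + 2 * t + 1)%N.
Proof.
move=> t_gt0.
(* The left summand indexes the rows y = q j with 0 <= j <= t, where x = j + l has t + 1 values. The
   right one indexes the rows y = q j + r + 1 with r < k and j < t, where x = j + l + 1 has t
   values. The total is (t + 1)^2 + k t^2. *)
pose I : finType := (('I_t.+1 * 'I_t.+1) + ('I_k * 'I_t * 'I_t))%type.
pose f0 (i : I) : nat * nat := match i with
  | inl (j, l) => (j + l, q * j)%N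
  | inr (r, j, l) => (j + l.+1, q * j + r.+1)%N
  end.
have modq a r : (r < q)%N -> ((q * a + r) %% q = r)%N.
  by move=> rq; rewrite mulnC modnMDl modn_small.
have modq0 a : ((q * a) %% q = 0)%N by rewrite -[(q * a)%N]addn0 modq.
(* The residue of the second coordinate mod [q] separates the two summands and recovers [r]; the
   quotient then gives [j], and the first coordinate gives [l]. *)
have f0_inj : injective f0.
  move=> [[j l]|[[r j] l]] [[j' l']|[[r' j'] l']] [].
  - move=> e1 /eqP; rewrite eqn_pmul2l // => /eqP e2.
    by congr (inl (_, _)); apply: val_inj => /=; lia.
  - by move=> _ /(congr1 (modn^~ q)); rewrite modq0 modq // ltnS ltn_ord.
  - by move=> _ /(congr1 (modn^~ q)); rewrite modq0 modq // ltnS ltn_ord.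
  - move=> e1 e2; have er : r.+1 = r'.+1.
      by have /(congr1 (modn^~ q)) := e2; rewrite !modq // ltnS ltn_ord.
    move: e2; rewrite er => /addIn/eqP; rewrite eqn_pmul2l // => /eqP ej.
    by congr (inr (_, _, _)); apply: val_inj => /=; lia.
pose f i := rV2 (f0 i).1%:R (f0 i).2%:R.
have f_inj : injective f.
  move=> i i' /[dup] /(congr1 (fun z : 'rV_2 => z 0 0)) + /(congr1 (fun z : 'rV_2 => z 0 1)).
  rewrite !rV20 !rV21 => /eqP; rewrite eqr_nat => /eqP e1 /eqP; rewrite eqr_nat => /eqP e2.
  by apply: f0_inj; rewrite [LHS]surjective_pairing e1 e2 -surjective_pairing.
rewrite /lattice_count dilate_parallelogram // (_ : _ `&` _ = f @` setT).
  rewrite card_fset_set_image // (_ : #|` _|%fset = #|I|).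
    by rewrite card_sum !card_prod !card_ord /q; lia.
  rewrite cardE; apply/perm_size/uniq_perm; rewrite ?enum_uniq //.
  by move=> i; rewrite mem_enum in_fset_set ?in_setT //; apply: finite_finset.
apply/seteqP; split=> z; last first.
  move=> [i _ <-]; split; last first.
    by apply/mxOverP => a b; rewrite mxE; case: ifP; rewrite rpred_nat.
  rewrite /= rV20 rV21 -natrM ler0n ler_nat subr_ge0 lerBlDr -natrD !ler_nat /f.
  case: i => [[j l]|[[r j] l]] /=.
    have := ltn_ord j; have := ltn_ord l; nia.
  have := ltn_ord r; have := ltn_ord j; have := ltn_ord l; rewrite /q; nia.
move=> [[/andP[y0 yq] /andP[x0 xq]] /mxOverP z_int].
(* Both coordinates are nonnegative integers, so the rest can be done in [nat]. *)
have x_ge0 : 0 <= z 0 0.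
  have q_gt0 : 0 < q%:R :> R by rewrite ltr0n.
  by rewrite -(pmulr_rge0 _ q_gt0); lra.
have /natrP[a za] : z 0 0 \is a Num.nat by rewrite natrEint z_int.
have /natrP[b zb] : z 0 1 \is a Num.nat by rewrite natrEint z_int.
move: yq x0 xq; rewrite za zb -natrM subr_ge0 lerBlDr -natrD !ler_nat => yq x0 xq.
have bE := divn_eq b q; have r_lt : (b %% q < q)%N by rewrite ltn_mod.
set j := (b %/ q)%N in bE; set r := (b %% q)%N in bE r_lt.
suff [i fi] : exists i, f0 i = (a, b) by exists i; rewrite // /f fi [RHS]rV2E za zb.
have [r0|r_gt0] := posnP r.
  have jt : (j < t.+1)%N by nia.
  have lt : (a - j < t.+1)%N by nia.
  exists (inl (Ordinal jt, Ordinal lt)) => /=; congr pair; nia.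
(* The right summand stores a nonzero residue shifted down by one. *)
have rk : (r.-1 < k)%N by lia.
have jt : (j < t)%N by nia.
have lt : (a - j.+1 < t)%N by nia.
exists (inr (Ordinal rk, Ordinal jt, Ordinal lt)) => /=; congr pair; nia.
Qed.

End Parallelogram.

(** * Ehrhart polynomials of the constructions *)

Section Ehrhart.
Context {R : realType}.

(** Counting in the [t]-th dilate of mP is counting in the [t * m]-th dilate of [P]; positivity of
    [m] keeps this argument in the range where [ehrhart_poly] speaks. *)
Lemma ehrhart_poly_dilate {N} (P : set 'rV[R]_N) m p : (0 < m)%N ->
  ehrhart_poly P p ->
  ehrhart_poly [set m%:R *: x | x in P] (p \Po (m%:R *: 'X)).
Proof.
move=> m_gt0 ehrP t t_gt0; rewrite lattice_count_dilate // -ehrP ?muln_gt0 ?t_gt0 //.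
by rewrite horner_comp hornerZ hornerX natrM mulrC.
Qed.

Lemma ehrhart_poly_set_row_mx {N M} (P : set 'rV[R]_N) (T : set 'rV[R]_M) p r :
  ehrhart_poly P p -> ehrhart_poly T r -> ehrhart_poly (set_row_mx P T) (p * r).
Proof.
move=> ehrP ehrT t t_gt0.
by rewrite lattice_count_set_row_mx natrM -ehrP // -ehrT // hornerM.
Qed.

Lemma ehrhart_poly_parallelogram k :
  ehrhart_poly (@parallelogram R k) (1 + 2 *: 'X + k.+1%:R *: 'X^2).
Proof.
move=> t t_gt0; rewrite lattice_count_parallelogram // -polyC1.
by rewrite !hornerD !hornerZ hornerXn hornerX hornerC !natrD !natrM; ring.
Qed.

End Ehrhart.

(** * Coefficients of polynomials and signs of dominated sums *)

Lemma one_add_sum_poly {R : nzRingType} (c : nat -> R) n :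
  1 + \sum_(1 <= i < n.+1) c i *: 'X^i =
  \poly_(i < n.+1) (if i == 0%N then 1 else c i).
Proof.
rewrite poly_def -(big_mkord xpredT (fun i => (if i == 0%N then 1 else c i) *: 'X^i)).
rewrite big_ltn //= scale1r expr0; congr (_ + _).
by apply: eq_big_nat => -[].
Qed.

Lemma coef_comp_scaleX {R : comNzRingType} (p : {poly R}) a i :
  (p \Po (a *: 'X))`_i = a ^+ i * p`_i.
Proof.
rewrite coef_comp_poly; under eq_bigr do rewrite exprZn coefZ coefXn.
have [i_lt|i_ge] := ltnP i (size p).
  rewrite (bigD1 (Ordinal i_lt)) //= eqxx mulr1 big1 ?addr0 1?mulrC // => j.
  by rewrite -val_eqE /= eq_sym => /negPf ->; rewrite !mulr0.
rewrite nth_default // mulr0 big1 // => j _.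
by rewrite gtn_eqF ?mulr0 // (leq_trans (ltn_ord j)).
Qed.

Lemma sgr_dominant {R : realDomainType} (x a z : R) :
  `|x| < a * `|z| -> Num.sg (x + a * z) = Num.sg z.
Proof.
rewrite ltr_norml => /andP[]; have [z0|z0|->] := ltrgt0P z.
- by move=> ? _; rewrite (gtr0_sg z0) gtr0_sg; lra.
- by move=> _ ?; rewrite (ltr0_sg z0) ltr0_sg; lra.
- by rewrite mulr0 oppr0 => ? ?; lra.
Qed.

(** The Archimedean property bounds each ratio of norms, and the maximum over the finite [I] makes
    the bound uniform. *)
Lemma exists_natr_dominant {R : archiNumFieldType} {I : finType} (x z : I -> R) :
  (forall i, z i != 0) -> exists k : nat, forall i, `|x i| < k.+1%:R * `|z i|.
Proof.
move=> z_neq0; pose b i := Num.bound (`|x i| / `|z i|).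
exists (\max_i b i) => i; rewrite -ltr_pdivrMr ?normr_gt0 //.
apply: lt_le_trans (archi_boundP _) _; first by rewrite divr_ge0.
by rewrite ler_nat ltnW // ltnS leq_bigmax.
Qed.

Theorem theorem6p3 (R : realType) (N d : nat) (P : set 'rV[R]_N) (c : nat -> R)
    (hd : (3 <= d)%N)
    (hP : integral_polytope P)
    (hdim : has_dim P d)
    (hE : ehrhart_poly P (1 + \sum_(1 <= i < d.+1) c i *: 'X^i))
    (hc : forall i : nat, (1 <= i <= d)%N -> c i != 0) :
  exists (M : nat) (Q : set 'rV[R]_M) (h : nat -> R),
    integral_polytope Q /\
    has_dim Q (d + 2) /\
    ehrhart_poly Q (1 + \sum_(1 <= i < (d + 2).+1) h i *: 'X^i) /\
    (forall i : nat, (4 <= i <= d)%N -> Num.sg (h i) = Num.sg (c (i - 2)%N)) /\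
    Num.sg (h 2%N) = 1 /\
    Num.sg (h 1%N) = Num.sg (c 1%N) /\
    Num.sg (h 3%N) = Num.sg (c 1%N).
Proof.
set C := 1 + _ in hE.
(* [C] acts as the sequence [c] with value 1 at index 0, so that index 0 is treated like the
   others. *)
have CE : C = \poly_(i < d.+1) (if i == 0%N then 1 else c i) by exact: one_add_sum_poly.
have C0 : C`_0 = 1 by rewrite CE coef_poly.
have Cc i : (1 <= i <= d)%N -> C`_i = c i.
  by case/andP=> i_gt0 i_le; rewrite CE coef_poly ltnS i_le gtn_eqF.
have C_neq0 i : (i <= d)%N -> C`_i != 0.
  by case: i => [|i] i_le; [rewrite C0 oner_neq0 | rewrite Cc ?hc].
have c1_neq0 : c 1%N != 0 by apply: hc; lia.
(* A family with one member: this gives 2 < (m + 1) |c_1|, and [m.+1] is the dilation factor. *)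
have [m /(_ tt)] := exists_natr_dominant (I := unit) (fun _ => 2 : R)
  (fun _ => c 1%N) (fun _ => c1_neq0).
set a := m.+1%:R => m_dom.
have a_gt0 : 0 < a by rewrite ltr0n.
pose D := C \Po (a *: 'X).
have DE i : D`_i = a ^+ i * C`_i by exact: coef_comp_scaleX.
have sgD i : Num.sg D`_i = Num.sg C`_i by rewrite DE sgrM gtr0_sg ?mul1r ?exprn_gt0.
have D_neq0 (i : 'I_d.+1) : D`_i != 0.
  by rewrite -sgr_eq0 sgD sgr_eq0 C_neq0 // -ltnS.
(* Chosen after [m], since the coefficients of [D] depend on it; one [k] serves all indices 0 to
   d. *)
have [k k_dom] := exists_natr_dominant (fun i : 'I_d.+1 => D`_i.+2 + 2 * D`_i.+1)
  (fun i => D`_i) D_neq0.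
pose H := D * (1 + 2 *: 'X + k.+1%:R *: 'X^2).
have H0 : H`_0 = 1.
  by rewrite /H !mulrDr !coefD mulr1 -!scalerAr !coefZ coefMX coefMXn /= DE C0; ring.
(* The area [k.+1] first enters at degree 2, so its choice leaves this coefficient intact. *)
have H1 : H`_1 = 2 + a * c 1%N.
  rewrite /H !mulrDr !coefD mulr1 -!scalerAr !coefZ coefMX coefMXn /= !DE C0 Cc; first ring.
  exact: leq_trans hd.
have H2 i : H`_i.+2 = (D`_i.+2 + 2 * D`_i.+1) + k.+1%:R * D`_i.
  by rewrite /H !mulrDr !coefD mulr1 -!scalerAr !coefZ coefMX coefMXn /= subn2.
have sgH i : (i <= d)%N -> Num.sg H`_i.+2 = Num.sg C`_i.
  by rewrite -ltnS => i_le; rewrite H2 (sgr_dominant _ _ _ (k_dom (Ordinal i_le))) sgD.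
(* The prescribed form fits because [H] has constant term 1 and, [C] having degree at most d, no
   terms beyond degree d + 2. *)
have HE : 1 + \sum_(1 <= i < (d + 2).+1) H`_i *: 'X^i = H.
  rewrite one_add_sum_poly; apply/polyP => i; rewrite coef_poly.
  have [i_lt|i_ge] := ltnP; first by case: eqP => [->|].
  have Cge j : (d < j)%N -> C`_j = 0 by move=> dj; rewrite CE coef_poly ltnNge dj.
  case: i i_ge => [|[|i]] //; rewrite ?addn2 // => i_ge.
  by rewrite H2 !DE !Cge //; first ring; lia.
exists (N + 2)%N, (set_row_mx [set a *: x | x in P] (parallelogram k)), (fun i => H`_i).
split; [|split; [|split; [|split; [|split; [|split]]]]].
- by apply: set_row_mx_integral; [apply: dilate_integral|apply: parallelogram_integral].
- by apply: set_row_mx_has_dim; [apply: dilate_has_dim|apply: parallelogram_has_dim].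
- rewrite HE; apply: ehrhart_poly_set_row_mx; first exact: ehrhart_poly_dilate.
  exact: ehrhart_poly_parallelogram.
- move=> [|[|i]] //; case/andP=> i4 i_le.
  by rewrite subn2 sgH ?Cc //; lia.
(* The sign of h_2 is that of the constant term 1 of [C]. *)
- by rewrite sgH // C0 sgr1.
- by rewrite H1 sgr_dominant.
- by rewrite sgH ?Cc //; lia.
Qed.
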